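(* If $\mathcal{F}$ is a finitary argumentation framework, then it has an $\mathit{stg1.5}$-extension, i.e., $\mathit{stg1.5}(\mathcal{F})\neq\emptyset$.
   Context: An argumentation framework (AF) is $\mathcal{F}=(A_{\mathcal{F}},R_{\mathcal{F}})$ with $R_{\mathcal{F}}\subseteq A_{\mathcal{F}}\times A_{\mathcal{F}}$ (possibly infinite); $a\rightarrow b$ means $(a,b)\in R_{\mathcal{F}}$. $\mathcal{F}$ is finitary if each argument is attacked by only finitely many arguments. $\mathcal{F}|_S=(A_{\mathcal{F}}\cap S,R_{\mathcal{F}}\cap(S\times S))$. $S$ is conflict-free if no $a,b\in S$ have $a\rightarrow b$; $S^\oplus=S\cup\{x:\exists y\in S,\ y\rightarrow x\}$; a stage extension of an AF is a conflict-free $S$ such that there is no conflict-free $T$ with $S^\oplus\subsetneq T^\oplus$. $\mathrm{SCC}(\mathcal{F})$ is the set of strongly connected components of the attack graph (paths possibly of length 0). For $X,S\subseteq A_{\mathcal{F}}$, $D_S(X)=\{b\in X:\exists a\in S\setminus X,\ a\rightarrow b\}$. $S\in\mathit{stg1.5}(\mathcal{F})$ iff $S$ is conflict-free and for each $X\in\mathrm{SCC}(\mathcal{F})$, $S\cap X$ is a stage extension of $\mathcal{F}|_{X\setminus D_S(X)}$. *)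

(* Defs.v *)
(* An argumentation framework over a carrier type U is given by
   a set of arguments [Ar : U -> Prop] and an attack relation [At : U -> U -> Prop]
   with [At a b -> Ar a /\ Ar b] (R_F subset of A_F x A_F). Possibly infinite. *)
From Stdlib Require Import List Relations.

Set Implicit Arguments.

Section AF.
Variable U : Type.

Definition wf_AF (Ar : U -> Prop) (At : U -> U -> Prop) : Prop :=
  forall a b, At a b -> Ar a /\ Ar b.

Definition finitary (Ar : U -> Prop) (At : U -> U -> Prop) : Prop :=
  forall b, Ar b -> exists l : list U, forall a, At a b -> In a l.

Definition restr_args (Ar : U -> Prop) (S : U -> Prop) : U -> Prop :=
  fun x => Ar x /\ S x.
Definition restr_att (At : U -> U -> Prop) (S : U -> Prop) : U -> U -> Prop :=
  fun a b => At a b /\ S a /\ S b.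

Definition conflict_free (Ar : U -> Prop) (At : U -> U -> Prop) (S : U -> Prop) : Prop :=
  (forall x, S x -> Ar x) /\ (forall a b, S a -> S b -> ~ At a b).

Definition range (At : U -> U -> Prop) (S : U -> Prop) : U -> Prop :=
  fun x => S x \/ exists y, S y /\ At y x.

Definition stage (Ar : U -> Prop) (At : U -> U -> Prop) (S : U -> Prop) : Prop :=
  conflict_free Ar At S /\
  ~ (exists T, conflict_free Ar At T /\
       (forall x, range At S x -> range At T x) /\
       (exists x, range At T x /\ ~ range At S x)).

Definition reach (At : U -> U -> Prop) : U -> U -> Prop := clos_refl_trans U At.

Definition is_SCC (Ar : U -> Prop) (At : U -> U -> Prop) (X : U -> Prop) : Prop :=
  exists a, Ar a /\
    forall b, X b <-> (Ar b /\ reach At a b /\ reach At b a).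

Definition D_set (At : U -> U -> Prop) (S X : U -> Prop) : U -> Prop :=
  fun b => X b /\ exists a, S a /\ ~ X a /\ At a b.

Definition stg15 (Ar : U -> Prop) (At : U -> U -> Prop) (S : U -> Prop) : Prop :=
  conflict_free Ar At S /\
  forall X, is_SCC Ar At X ->
    let Y := fun x => X x /\ ~ D_set At S X x in
    stage (restr_args Ar Y) (restr_att At Y) (fun x => S x /\ X x).

End AF.

(* Main.v *)
Require Import Defs.
From Stdlib Require Import List Relations Lia Cantor Classical ClassicalEpsilon.
From Stdlib Require Import FunctionalExtensionality PropExtensionality.
From mathcomp Require filter.

(** A strongly connected component of a finitary framework is countable, so it
    can be enumerated as [x_0, x_1, ...].  Ask of [S] that, on each component,
    its range be lexicographically maximal along this enumeration: [x_n] is in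
    the range as soon as some admissible [T] covers [x_n] and all the [x_m],
    [m < n], covered by [S].  This implies the stage condition, and each single
    instance of it depends on finitely many arguments only, because a finite
    part of [T] suffices to cover [x_0, ..., x_n].  Finitely many instances can
    be satisfied by treating the components involved in topological order, so
    an ultrafilter limit of these approximations satisfies all of them.  The
    components need not be well-founded, which is why compactness is used
    rather than recursion on components. *)

(** * Ultrafilter limits and finite lexicographic choice *)

Lemma finite_coordinate_limit (U I : Type) (F : list I -> U -> Prop) :
  exists S : U -> Prop, forall (Z : list U) (L0 : list I),
    exists L, incl L0 L /\ forall z, In z Z -> (F L z <-> S z).
Proof.
(* [G] is generated by the cones of lists containing a given [L0]. An ultrafilter above it decides
   every coordinate [z], and any finitely many decisions hold together at some [L] of any cone. *)
pose (G := fun P : list I -> Prop => exists L0, forall L, incl L0 L -> P L).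
assert (PG : filter.ProperFilter G).
{ split.
  - intros [L0 H]. exact (H L0 (incl_refl L0)).
  - split.
    + exists nil. intros; exact Logic.I.
    + intros P Q [L1 H1] [L2 H2]. exists (L1 ++ L2). intros L H. split.
      * apply H1. intros i Hi. apply H, in_or_app; auto.
      * apply H2. intros i Hi. apply H, in_or_app; auto.
    + intros P Q PQ [L0 H]. exists L0. intros L HL. apply PQ, H, HL. }
destruct (filter.ultraFilterLemma PG) as [W [WU GW]].
pose proof (@filter.ultra_proper _ _ WU) as WP.
pose proof (@filter.filter_filter _ _ WP) as WF.
exists (fun z => W (fun L => F L z)).
intros Z L0.
assert (H : W (fun L => incl L0 L /\
              forall z, In z Z -> (F L z <-> W (fun L => F L z)))).
{ induction Z as [|z Z IH].
  - apply GW. exists L0. intros L HL. split; [exact HL|]. intros z [].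
  - assert (Hz : W (fun L => F L z <-> W (fun L => F L z))).
    { destruct (filter.in_ultra_setVsetC (fun L => F L z) WU) as [h|h].
      - refine (filter.filterS _ h). intros L HL. split; auto.
      - refine (filter.filterS _ h). intros L HL. split; [intro; contradiction|].
        intro h'. exfalso. apply (@filter.filter_not_empty _ _ WP).
        refine (filter.filterS _ (filter.filterI h h')).
        intros L' [A B]. exact (A B). }
    refine (filter.filterS _ (filter.filterI IH Hz)).
    intros L [[A B] C]. split; [exact A|].
    intros z' [<-|Hin]; auto. }
apply NNPP. intro N. apply (@filter.filter_not_empty _ _ WP).
refine (filter.filterS _ H). intros L HL. apply N. exists L. exact HL.
Qed.

(** Induction on [N]: an optimal [v] is kept, or replaced by some [w] that meets all [v] meets below
    [N] and also [N] itself. Below [N] the new [w] stays optimal, because a competitor of [w] there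
    also competes with [v]. *)
Lemma greedy_choice (V : Type) (P : V -> Prop) (R : V -> nat -> Prop) (N : nat) :
  (exists v, P v) ->
  exists v, P v /\ forall n, n < N -> forall w, P w ->
    (forall m, m < n -> R v m -> R w m) -> R w n -> R v n.
Proof.
intro HP. induction N as [|N [v [Pv Hv]]].
- destruct HP as [v Pv]. exists v. split; [exact Pv|]. intros; lia.
- destruct (classic (exists w, P w /\ (forall m, m < N -> R v m -> R w m) /\ R w N))
    as [[w [Pw [Hw Rw]]]|Hno].
  + exists w. split; [exact Pw|]. intros n Hn w' Pw' Hm Rn.
    destruct (PeanoNat.Nat.eq_dec n N) as [->|Hne]; [exact Rw|].
    apply Hw; [lia|]. apply (Hv n) with w'; auto; [lia|].
    intros m Hmn Rm. apply Hm; [exact Hmn|]. apply Hw; [lia|exact Rm].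
  + exists v. split; [exact Pv|]. intros n Hn w' Pw' Hm Rn.
    destruct (PeanoNat.Nat.eq_dec n N) as [->|Hne].
    * exfalso. apply Hno. exists w'. auto.
    * apply (Hv n) with w'; auto. lia.
Qed.

(** * Topological order of finitely many components *)

Section StrongComponents.
Context {U : Type} (At : U -> U -> Prop).

Definition mutual (a b : U) : Prop := reach At a b /\ reach At b a.

Lemma mutual_refl a : mutual a a.
Proof. split; apply rt_refl. Qed.

Lemma mutual_sym a b : mutual a b -> mutual b a.
Proof. intros [H K]; split; assumption. Qed.

Lemma mutual_trans a b c : mutual a b -> mutual b c -> mutual a c.
Proof.
intros [H K] [H' K']; split; eapply rt_trans; eassumption.
Qed.

(* The later a component comes in the list, the earlier it is in attack order. *)
Fixpoint topo_sorted (l : list U) : Prop :=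
  match l with
  | nil => True
  | a :: l => (forall b, In b l -> reach At a b -> reach At b a) /\ topo_sorted l
  end.

(** Put [c] just before the first entry [a] that reaches it. If [c] reaches a later [b], so does
    [a]; hence [b] leads back to [a] and on to [c]. *)
Lemma topo_sorted_insert (c : U) (l : list U) :
  topo_sorted l ->
  exists l', topo_sorted l' /\ forall x, In x l' <-> In x (c :: l).
Proof.
induction l as [|a l IH]; intro Hl.
- exists (c :: nil). split; [|tauto]. split; [intros b []|exact Logic.I].
- destruct Hl as [Ha Hl]. destruct (classic (reach At a c)) as [Hac|Hac].
  + exists (c :: a :: l). split; [|tauto]. split; [|split; assumption].
    intros b [<-|Hb] Hcb; [exact Hac|].
    apply rt_trans with a; [|exact Hac]. apply Ha; [exact Hb|].
    apply rt_trans with c; assumption.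
  + destruct (IH Hl) as [l' [S' E']]. exists (a :: l'). split.
    * split; [|exact S']. intros b Hb Hab. apply E' in Hb.
      destruct Hb as [<-|Hb]; [contradiction|]. apply Ha; assumption.
    * intro x. simpl. rewrite E'. simpl. tauto.
Qed.

Lemma topo_sort (l : list U) :
  exists l', topo_sorted l' /\ forall x, In x l' <-> In x l.
Proof.
induction l as [|a l [l1 [S1 E1]]].
- exists nil. split; [exact Logic.I|tauto].
- destruct (topo_sorted_insert a l1 S1) as [l2 [S2 E2]].
  exists l2. split; [exact S2|]. intro x. rewrite E2. simpl. rewrite E1. tauto.
Qed.

End StrongComponents.

(** * Enumerating the components of a finitary framework *)

Section Finitary.
Context {U : Type} (Ar : U -> Prop) (At : U -> U -> Prop).
Hypotheses (Hwf : wf_AF Ar At) (Hfin : finitary Ar At).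

Notation mutual := (mutual At).

Lemma reach_args a b : reach At a b -> Ar b -> Ar a.
Proof.
intro H. induction H as [a b Hab| |a b c _ IH1 _ IH2]; auto.
intros _. exact (proj1 (Hwf _ _ Hab)).
Qed.

Lemma attackers_list :
  exists att : U -> list U, forall a b, At a b -> In a (att b).
Proof.
assert (H : forall b, exists l : list U, forall a, At a b -> In a l).
{ intro b. destruct (classic (Ar b)) as [Hb|Hb]; [exact (Hfin _ Hb)|].
  exists nil. intros a Hab. exact (Hb (proj2 (Hwf _ _ Hab))). }
exists (fun b => proj1_sig (constructive_indefinite_description _ (H b))).
intros a b. apply (proj2_sig (constructive_indefinite_description _ (H b))).
Qed.

(** A backward walk from [a] is coded by its length [k] and a number [m] packing the positions
    chosen in the successive attacker lists. Values of [e] that are not ancestors do no harm, so any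
    default serves in [nth]. *)
Lemma enum_ancestors (a : U) :
  exists e : nat -> U, forall b, reach At b a -> exists n, e n = b.
Proof.
destruct attackers_list as [att Hatt].
pose (anc := fix anc (k m : nat) : U :=
  match k with
  | 0 => a
  | S k => let (i, m') := Cantor.of_nat m in nth i (att (anc k m')) a
  end).
assert (anc_0 : forall m, anc 0 m = a) by reflexivity.
assert (anc_S : forall k i m,
  anc (S k) (Cantor.to_nat (i, m)) = nth i (att (anc k m)) a).
{ intros k i m. unfold anc at 1. rewrite Cantor.cancel_of_to. reflexivity. }
clearbody anc.
exists (fun n => let (k, m) := Cantor.of_nat n in anc k m).
intros b Hb. apply clos_rt_rt1n in Hb.
assert (H : exists k m, anc k m = b).
{ induction Hb as [a|b c a Hbc _ IH]; [exists 0, 0; apply anc_0|].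
  destruct (IH anc_0 anc_S) as [k [m Hkm]].
  destruct (In_nth _ _ a (Hatt _ _ Hbc)) as [i [_ Hi]].
  exists (S k), (Cantor.to_nat (i, m)). rewrite anc_S, Hkm. exact Hi. }
destruct H as [k [m H]]. exists (Cantor.to_nat (k, m)).
rewrite Cantor.cancel_of_to. exact H.
Qed.

Lemma enum_components :
  exists E : U -> nat -> U,
    (forall a b, mutual a b -> E a = E b) /\ (forall a, exists n, E a n = a).
Proof.
pose (rep := fun a : U => epsilon (inhabits a) (mutual a)).
pose (e := fun a => proj1_sig
  (constructive_indefinite_description _ (enum_ancestors a))).
assert (Hrep : forall a, mutual a (rep a)).
{ intro a. apply epsilon_spec. exists a. apply mutual_refl. }
exists (fun a => e (rep a)). split.
- intros a b Hab. f_equal. unfold rep.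
  (* Extensionality makes the two predicates equal, so [epsilon] picks the same representative for
     both. *)
  replace (mutual b) with (mutual a); [|].
  + f_equal. apply proof_irrelevance.
  + apply functional_extensionality. intro x. apply propositional_extensionality.
    split; intro H; [apply mutual_sym in Hab|]; eapply mutual_trans; eassumption.
- intro a. unfold e.
  apply (proj2_sig (constructive_indefinite_description _ (enum_ancestors (rep a)))).
  apply Hrep.
Qed.

(* For [x] in a component [X], this says that [x] is in [X \ D_S(X)]. *)
Definition available (S : U -> Prop) (x : U) : Prop :=
  Ar x /\ ~ exists y, S y /\ ~ mutual x y /\ At y x.

(** For conflict-free [S] and [x] in [X \ D_S(X)], this is the range of [S] restricted to [X], taken
    in the framework on [X \ D_S(X)]. *)
Definition local_range (S : U -> Prop) (x : U) : Prop :=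
  S x \/ exists y, S y /\ mutual x y /\ At y x.

(** Not admissibility in Dung's sense: these are the conflict-free sets of the available part of the
    component of [a]. *)
Definition admissible_in (S : U -> Prop) (a : U) (T : U -> Prop) : Prop :=
  (forall y, T y -> available S y /\ mutual a y) /\
  (forall y z, T y -> T z -> ~ At y z).

(** * Lexicographic maximality along the enumerations *)

Context (E : U -> nat -> U).
Hypotheses (E_mutual : forall a b, mutual a b -> E a = E b)
           (E_onto : forall a, exists n, E a n = a).

(** [E a] may leave the component of [a]; the first conjunct discards such indices. *)
Definition covers (S T : U -> Prop) (a : U) (m : nat) : Prop :=
  mutual a (E a m) /\ available S (E a m) /\ local_range T (E a m).

Definition greedy_at (S : U -> Prop) (a : U) (n : nat) : Prop :=
  forall T, admissible_in S a T ->
    (forall m, m < n -> covers S S a m -> covers S T a m) ->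
    covers S T a n -> covers S S a n.

Lemma greedy_at_mutual (S : U -> Prop) a b n :
  mutual a b -> greedy_at S a n -> greedy_at S b n.
Proof.
intros Hab Ha T [HT HT'] Hm Hn.
assert (Hc : forall T m, covers S T a m <-> covers S T b m).
{ intros T1 m. unfold covers. rewrite (E_mutual _ _ Hab).
  split; intros [H ?]; (split; [|assumption]).
  - apply mutual_trans with a; [apply mutual_sym|]; assumption.
  - apply mutual_trans with b; assumption. }
apply Hc, (Ha T).
- split; [|exact HT']. intros y Hy. destruct (HT y Hy) as [H1 H2].
  split; [exact H1|]. apply mutual_trans with b; assumption.
- intros m Hmn H. apply Hc, Hm; [exact Hmn|]. apply Hc, H.
- apply Hc, Hn.
Qed.

(** The tail of the list is solved first. If the component of [a] is new, [greedy_choice] supplies a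
    [T] inside it, and [T] is added to the solution [S] of the tail. *)
Lemma finite_greedy (N : nat) (l : list U) :
  topo_sorted At l ->
  exists S, conflict_free Ar At S /\
    (forall x, S x -> exists b, In b l /\ mutual b x) /\
    (forall a n, In a l -> n < N -> greedy_at S a n).
Proof.
induction l as [|a l IH]; intro Hl.
{ exists (fun _ => False). split; [split; tauto|]. split; [tauto|]. intros a n []. }
destruct Hl as [Ha Hl]. destruct (IH Hl) as [S [[SA Scf] [Sl Sg]]].
destruct (classic (exists b, In b l /\ mutual a b)) as [[b [Hb Hab]]|Hnew].
{ exists S. split; [split; assumption|]. split.
  - intros x Hx. destruct (Sl x Hx) as [c [Hc Hcx]]. exists c. split; [right|]; assumption.
  - intros c n [<-|Hc] Hn; [|apply Sg; assumption].
    apply greedy_at_mutual with b; [apply mutual_sym, Hab|]. apply Sg; assumption. }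
destruct (@greedy_choice _ (admissible_in S a) (fun T => covers S T a) N)
  as [T [[TA Tcf] Tg]].
{ exists (fun _ => False). split; tauto. }
assert (Hdisj : forall s, S s -> ~ mutual a s).
{ intros s Hs Has. destruct (Sl s Hs) as [b [Hb Hbs]]. apply Hnew. exists b.
  split; [exact Hb|]. apply mutual_trans with s; [exact Has|]. apply mutual_sym, Hbs. }
(* [T] attacks no listed component, since these are not reachable from [a]. *)
assert (Hout : forall t y b, T t -> In b l -> mutual b y -> ~ At t y).
{ intros t y b Ht Hb [_ Hyb] Hty. destruct (TA t Ht) as [_ [Hat _]].
  assert (Hab : reach At a b).
  { apply rt_trans with t; [exact Hat|]. apply rt_trans with y; [|exact Hyb].
    apply rt_step, Hty. }
  apply Hnew. exists b. split; [exact Hb|]. split; [exact Hab|]. apply Ha; assumption. }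
assert (Hin : forall t y b, T t -> In b l -> mutual b y -> ~ mutual y t).
{ intros t y b Ht Hb Hby Hyt. apply Hnew. exists b. split; [exact Hb|].
  apply mutual_trans with t; [exact (proj2 (TA t Ht))|]. apply mutual_sym.
  apply mutual_trans with y; assumption. }
pose (S' := fun x => S x \/ T x).
(* Passing from [S] to [S'] changes nothing on listed components. On the component of [a],
   availability still depends on [S] alone and the local range on [T] alone. *)
assert (Av_old : forall b y, In b l -> mutual b y -> (available S' y <-> available S y)).
{ intros b y Hb Hby. split; intros [Hy H]; (split; [exact Hy|]); intros [z [Hz [Hyz Hat]]]; apply H.
  - exists z. split; [left|]; auto.
  - destruct Hz as [Hz|Hz]; [exists z; auto|]. destruct (Hout z y b Hz Hb Hby Hat). }
assert (Rg_old : forall b y, In b l -> mutual b y -> (local_range S' y <-> local_range S y)).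
{ intros b y Hb Hby. split.
  - intros [[H|H]|[z [[H|H] [Hyz Hat]]]].
    + left; exact H.
    + destruct (Hin y y b H Hb Hby). apply mutual_refl.
    + right. exists z. auto.
    + destruct (Hout z y b H Hb Hby Hat).
  - intros [H|[z [H Hz]]]; [left; left; exact H|]. right. exists z. split; [left|]; assumption. }
assert (Av_new : forall y, mutual a y -> (available S' y <-> available S y)).
{ intros y Hay. split; intros [Hy H]; (split; [exact Hy|]); intros [z [Hz [Hyz Hat]]]; apply H.
  - exists z. split; [left|]; auto.
  - destruct Hz as [Hz|Hz]; [exists z; auto|]. destruct Hyz.
    apply mutual_trans with a; [apply mutual_sym, Hay|]. exact (proj2 (TA z Hz)). }
assert (Rg_new : forall y, mutual a y -> (local_range S' y <-> local_range T y)).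
{ intros y Hay. split.
  - intros [[H|H]|[z [[H|H] [Hyz Hat]]]].
    + destruct (Hdisj y H Hay).
    + left; exact H.
    + destruct (Hdisj z H). apply mutual_trans with y; assumption.
    + right. exists z. auto.
  - intros [H|[z [H Hz]]]; [left; right; exact H|]. right. exists z. split; [right|]; assumption. }
exists S'. split; [split|split].
- intros x [Hx|Hx]; [exact (SA x Hx)|]. exact (proj1 (proj1 (TA x Hx))).
- intros x y [Hx|Hx] [Hy|Hy] Hxy.
  + exact (Scf x y Hx Hy Hxy).
  + destruct (TA y Hy) as [[_ Hno] Hay]. apply Hno. exists x. split; [exact Hx|].
    split; [|exact Hxy]. intro Hyx. apply (Hdisj x Hx).
    apply mutual_trans with y; assumption.
  + destruct (Sl y Hy) as [b [Hb Hby]]. exact (Hout x y b Hx Hb Hby Hxy).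
  + exact (Tcf x y Hx Hy Hxy).
- intros x [Hx|Hx].
  + destruct (Sl x Hx) as [b [Hb Hbx]]. exists b. split; [right|]; assumption.
  + exists a. split; [left; reflexivity|]. exact (proj2 (TA x Hx)).
- intros c n Hc Hn V [VA Vcf] Hm HV.
  destruct (classic (In c l)) as [Hcl|Hcl].
  + assert (Hcov : forall m, covers S' S' c m <-> covers S S c m).
    { intro m. unfold covers. split; intros [H1 [H2 H3]]; (split; [exact H1|]);
        (split; [apply (Av_old c _ Hcl H1), H2|apply (Rg_old c _ Hcl H1), H3]). }
    assert (HcovV : forall m, covers S' V c m <-> covers S V c m).
    { intro m. unfold covers. split; intros [H1 [H2 H3]]; (split; [exact H1|]);
        (split; [apply (Av_old c _ Hcl H1), H2|exact H3]). }
    apply Hcov, (Sg c n Hcl Hn V).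
    * split; [|exact Vcf]. intros y Hy. destruct (VA y Hy) as [H1 H2].
      split; [|exact H2]. apply (Av_old c); assumption.
    * intros m Hmn H. apply HcovV, Hm; [exact Hmn|]. apply Hcov, H.
    * apply HcovV, HV.
  + destruct Hc as [<-|Hc]; [|contradiction].
    assert (Hcov : forall m, covers S' S' a m <-> covers S T a m).
    { intro m. unfold covers. split; intros [H1 [H2 H3]]; (split; [exact H1|]);
        (split; [apply (Av_new _ H1), H2|apply (Rg_new _ H1), H3]). }
    assert (HcovV : forall m, covers S' V a m <-> covers S V a m).
    { intro m. unfold covers. split; intros [H1 [H2 H3]]; (split; [exact H1|]);
        (split; [apply (Av_new _ H1), H2|exact H3]). }
    apply Hcov, (Tg n Hn V).
    * split; [|exact Vcf]. intros y Hy. destruct (VA y Hy) as [H1 H2].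
      split; [|exact H2]. apply Av_new; assumption.
    * intros m Hmn H. apply HcovV, Hm; [exact Hmn|]. apply Hcov, H.
    * apply HcovV, HV.
Qed.

Lemma finite_greedy_pairs (L : list (U * nat)) :
  exists S, conflict_free Ar At S /\
    forall a n, In (a, n) L -> greedy_at S a n.
Proof.
destruct (topo_sort At (map fst L)) as [l [Hl El]].
destruct (finite_greedy (1 + list_max (map snd L)) l Hl) as [S [Scf [_ Sg]]].
exists S. split; [exact Scf|]. intros a n Hin. apply Sg.
- apply El. apply in_map_iff. exists (a, n). auto.
- pose proof (proj1 (list_max_le (map snd L) _) (le_n _)) as Hmax.
  rewrite Forall_forall in Hmax.
  apply PeanoNat.Nat.lt_succ_r, Hmax, in_map_iff. exists (a, n). auto.
Qed.

Lemma greedy_exists :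
  exists S, conflict_free Ar At S /\ forall a n, greedy_at S a n.
Proof.
pose (F := fun L => proj1_sig
  (constructive_indefinite_description _ (finite_greedy_pairs L))).
assert (HF : forall L, conflict_free Ar At (F L) /\
                       forall a n, In (a, n) L -> greedy_at (F L) a n).
{ intro L. apply (proj2_sig
    (constructive_indefinite_description _ (finite_greedy_pairs L))). }
clearbody F.
destruct (finite_coordinate_limit _ _ F) as [S HS]. exists S. split; [split|].
- intros x Hx. destruct (HS (x :: nil) nil) as [L [_ HL]].
  apply (HF L). apply HL; [left; reflexivity|exact Hx].
- intros x y Hx Hy. destruct (HS (x :: y :: nil) nil) as [L [_ HL]].
  apply (HF L); apply HL; simpl; auto.
- intros a n T [TA Tcf] Hm Hn.
  destruct attackers_list as [att Hatt].
  pose (close := fun l => l ++ flat_map att l).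
  assert (close_self : forall l x, In x l -> In x (close l)).
  { intros l x Hx. apply in_or_app. auto. }
  assert (close_att : forall l x y, In x l -> At y x -> In y (close l)).
  { intros l x y Hx Hyx. apply in_or_app. right. apply in_flat_map.
    exists x. auto. }
  pose (P := map (E a) (seq 0 (1 + n))).
  assert (HP : forall m, m <= n -> In (E a m) P).
  { intros m Hmn. apply in_map, in_seq. lia. }
  clearbody P.
  (* The first closure holds the attackers that decide local ranges on [P]; the second holds those
     that decide availability on [close P]. *)
  destruct (HS (close (close P)) ((a, n) :: nil)) as [L [HinL HL]].
  pose proof (proj2 (HF L) a n (HinL _ (or_introl eq_refl))) as G.
  assert (Av : forall y, In y (close P) -> (available (F L) y <-> available S y)).
  { intros y Hy. split; intros [Hya H]; (split; [exact Hya|]);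
      intros [z [Hz [Hyz Hzy]]]; apply H; exists z; (split; [|auto]);
      apply HL; eauto. }
  assert (Rg : forall y, In y P -> (local_range (F L) y <-> local_range S y)).
  { intros y Hy. split; (intros [H|[z [Hz [Hyz Hzy]]]];
      [left; apply HL; auto|right; exists z; split; [apply HL; eauto|auto]]). }
  (* [T] may be infinite, while [F L] agrees with [S] only on a finite set. The truncation [T0]
     covers the same points of [P], and its points are available for [F L] too. *)
  pose (T0 := fun y => T y /\ In y (close P)).
  assert (Rg0 : forall y, In y P -> (local_range T0 y <-> local_range T y)).
  { intros y Hy. split.
    - intros [[H _]|[z [[Hz _] H]]]; [left; exact H|]. right. exists z. auto.
    - intros [H|[z [Hz [Hyz Hzy]]]].
      + left. split; auto.
      + right. exists z. split; [split; [exact Hz|eauto]|auto]. }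
  assert (Cov : forall m, m <= n -> (covers (F L) (F L) a m <-> covers S S a m)).
  { intros m Hmn. unfold covers.
    rewrite (Av (E a m)), (Rg (E a m)) by auto. tauto. }
  assert (Cov0 : forall m, m <= n -> (covers (F L) T0 a m <-> covers S T a m)).
  { intros m Hmn. unfold covers.
    rewrite (Av (E a m)), (Rg0 (E a m)) by auto. tauto. }
  apply (Cov n (le_n n)), (G T0).
  + split; [|intros y z [Hy _] [Hz _]; exact (Tcf y z Hy Hz)].
    intros y [Hy Hin]. destruct (TA y Hy) as [H1 H2].
    split; [apply Av; assumption|exact H2].
  + intros m Hmn H. apply Cov0; [lia|]. apply Hm; [exact Hmn|]. apply Cov; [lia|exact H].
  + apply (Cov0 n (le_n n)), Hn.
Qed.

(** A set [T] of strictly larger range gains some [x], listed as [E a n]. It also covers all that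
    [S] covers, so the instance of [greedy_at] at [n] already puts [x] in the range of [S]. *)
Lemma greedy_stg15 (S : U -> Prop) :
  conflict_free Ar At S -> (forall a n, greedy_at S a n) -> stg15 Ar At S.
Proof.
intros [SA Scf] Sg. split; [split; assumption|].
intros X [a [Ha HX]]. cbv zeta.
assert (Xm : forall x, X x <-> mutual a x).
{ intro x. rewrite HX. split; [intros [_ H]; exact H|]. intro H.
  split; [|exact H]. exact (reach_args _ _ (proj2 H) Ha). }
assert (Xmm : forall x y, X x -> (X y <-> mutual x y)).
{ intros x y Hx. apply Xm in Hx. rewrite Xm. split; intro H.
  - apply mutual_trans with a; [apply mutual_sym|]; assumption.
  - apply mutual_trans with x; assumption. }
assert (YAv : forall x, X x -> (available S x <-> ~ D_set At S X x)).
{ intros x Hx. split.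
  - intros [_ H] [_ [y [Hy [HXy Hyx]]]]. apply H. exists y.
    split; [exact Hy|]. split; [|exact Hyx]. rewrite <- (Xmm x y Hx). exact HXy.
  - intro H. split; [exact (proj1 (proj1 (HX x) Hx))|].
    intros [y [Hy [HXy Hyx]]]. apply H. split; [exact Hx|]. exists y.
    split; [exact Hy|]. split; [|exact Hyx]. rewrite (Xmm x y Hx). exact HXy. }
set (Y := fun x => X x /\ ~ D_set At S X x).
assert (SY : forall x, S x -> X x -> Y x).
{ intros x Hx HXx. split; [exact HXx|]. intros [_ [y [Hy [_ Hyx]]]].
  exact (Scf y x Hy Hx Hyx). }
split.
{ split.
  - intros x [Hx HXx]. split; [exact (SA x Hx)|]. apply SY; assumption.
  - intros x y [Hx _] [Hy _] [Hxy _]. exact (Scf x y Hx Hy Hxy). }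
intros [T [[TA Tcf] [Hsub [x [HTx HSx]]]]].
assert (TY : forall y, T y -> Y y) by (intros y Hy; exact (proj2 (TA y Hy))).
assert (RT : forall y, Y y -> (range (restr_att At Y) T y <-> local_range T y)).
{ intros y HYy. split.
  - intros [H|[z [Hz [Hzy [HYz _]]]]]; [left; exact H|]. right. exists z.
    split; [exact Hz|]. split; [|exact Hzy]. apply (Xmm y z (proj1 HYy)), HYz.
  - intros [H|[z [Hz [_ Hzy]]]]; [left; exact H|]. right. exists z.
    split; [exact Hz|]. split; auto. }
assert (RS : forall y, Y y ->
  (range (restr_att At Y) (fun x => S x /\ X x) y <-> local_range S y)).
{ intros y HYy. split.
  - intros [H|[z [[Hz HXz] [Hzy _]]]]; [left; exact (proj1 H)|]. right. exists z.
    split; [exact Hz|]. split; [|exact Hzy]. apply (Xmm y z (proj1 HYy)), HXz.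
  - intros [H|[z [Hz [Hyz Hzy]]]]; [left; split; [exact H|exact (proj1 HYy)]|].
    assert (HXz : X z) by (apply (Xmm y z (proj1 HYy)), Hyz).
    right. exists z. split; [split; assumption|]. split; auto. }
assert (HYx : Y x).
{ destruct HTx as [H|[z [_ [_ [_ H]]]]]; auto. }
assert (Hax : mutual a x) by (apply Xm, HYx).
destruct (E_onto x) as [n Hn]. rewrite <- (E_mutual _ _ Hax) in Hn.
apply HSx, RS; [exact HYx|].
assert (C : covers S S a n).
{ apply (Sg a n T).
  - split.
    + intros y Hy. destruct (TY y Hy) as [H1 H2]. split; [apply YAv|apply Xm]; assumption.
    + intros y z Hy Hz Hyz. apply (Tcf y z Hy Hz). split; auto.
  - intros m _ [H1 [H2 H3]]. split; [exact H1|]. split; [exact H2|].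
    assert (HYm : Y (E a m)).
    { split; [apply Xm, H1|]. apply YAv; [apply Xm, H1|exact H2]. }
    apply RT; [exact HYm|]. apply Hsub. apply RS; assumption.
  - unfold covers. rewrite Hn. split; [exact Hax|]. split.
    + apply YAv; apply HYx.
    + apply RT; assumption. }
destruct C as [_ [_ C]]. rewrite Hn in C. exact C.
Qed.

End Finitary.

Theorem theorem5 (U : Type) (Ar : U -> Prop) (At : U -> U -> Prop)
  (Hwf : wf_AF Ar At) (Hfin : finitary Ar At) :
  exists S : U -> Prop, stg15 Ar At S.
Proof.
destruct (enum_components _ _ Hwf Hfin) as [E [E_mutual E_onto]].
destruct (greedy_exists _ _ Hwf Hfin E E_mutual) as [S [Scf Sg]].
exists S. exact (greedy_stg15 _ _ Hwf E E_mutual E_onto S Scf Sg).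
Qed.
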